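(* Let $\mathcal{G}$ be a strongly connected and weight-balanced digraph on $n\ge 2$ nodes with Laplacian $\mathsf{L}$, let $A_i\in\mathbb{R}^{m\times m}$, $b_i\in\mathbb{R}^m$ for $i\in\{1,\dots,n\}$, put $A=\sum_{i=1}^n A_i$, $b=\sum_{i=1}^n b_i$, and assume that the equation $Ax=b$ has at least one solution $x\in\mathbb{R}^m$. Let $\mathbf{L}=\mathsf{L}\otimes I_m$, $\mathbf{A}=\mathrm{blkdiag}(A_1,\dots,A_n)$, $\mathbf{b}=[b_1;\dots;b_n]$ and $U=\mathbf{1}_n\otimes I_m$. Then for all $\alpha,\beta>0$, any trajectory $\mathbf{x}(t)\in\mathbb{R}^{mn}$, $t\ge0$, of $$\dot{\mathbf{x}}=-\alpha\mathbf{L}\mathbf{x}-\beta\mathbf{A}^\top UU^\top(\mathbf{A}\mathbf{x}-\mathbf{b})$$ converges exponentially to a point of the form $\mathbf{x}^*=\mathbf{1}_n\otimes x^*$, where $x^*\in\mathbb{R}^m$ satisfies $Ax^*=b$.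
   Context: A weighted digraph $\mathcal{G}=(\mathcal{V},\mathcal{E},\mathsf{A})$ with $|\mathcal{V}|=n$ has adjacency matrix $\mathsf{A}\in\mathbb{R}^{n\times n}$ with $\mathsf{A}_{ij}>0$ if there is an edge from node $i$ to node $j$, and $\mathsf{A}_{ij}=0$ otherwise. The weighted out- and in-degrees of node $i$ are $\sum_{j}\mathsf{A}_{ij}$ and $\sum_{j}\mathsf{A}_{ji}$; $\mathsf{D}^{\mathrm{out}}$ and $\mathsf{D}^{\mathrm{in}}$ are the corresponding diagonal matrices. The graph is weight-balanced if $\mathsf{D}^{\mathrm{out}}=\mathsf{D}^{\mathrm{in}}$, and strongly connected if there is a directed path between any two distinct nodes. The Laplacian is $\mathsf{L}=\mathsf{D}^{\mathrm{in}}-\mathsf{A}$. $\mathbf{1}_n\in\mathbb{R}^n$ is the all-ones vector, $I_m$ the $m\times m$ identity, $\otimes$ the Kronecker product, $\mathrm{blkdiag}(A_1,\dots,A_n)\in\mathbb{R}^{mn\times mn}$ the block-diagonal matrix with the given diagonal blocks, and $[b_1;\dots;b_n]\in\mathbb{R}^{mn}$ the stacked vector. A trajectory $z(t)$ converges exponentially to $z^*$ if there are constants $C,\mu>0$ with $\|z(t)-z^*\|\le Ce^{-\mu t}$ for all $t\ge 0$. *)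

(* Defs.v *)
From HB Require Import structures.
From mathcomp Require Import all_boot all_order all_algebra.
From mathcomp Require Import mxtens.
From mathcomp Require Import all_classical all_reals all_analysis.

Set Implicit Arguments.
Unset Strict Implicit.
Unset Printing Implicit Defensive.

Import Order.TTheory GRing.Theory Num.Theory.
Import numFieldNormedType.Exports.

Local Open Scope classical_set_scope.
Local Open Scope ring_scope.

(* adj G i j is the weight of the edge from i to j. *)
Record wdigraph (R : realType) (n : nat) := WDigraph {
  edge : rel 'I_n;
  adj : 'M[R]_n;
  adj_gt0 : forall i j, edge i j -> 0 < adj i j;
  adj_eq0 : forall i j, ~~ edge i j -> adj i j = 0 }.

Definition outdeg_mx (R : realType) (n : nat) (G : wdigraph R n) : 'M[R]_n :=
  diag_mx (\row_i \sum_j adj G i j).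

Definition indeg_mx (R : realType) (n : nat) (G : wdigraph R n) : 'M[R]_n :=
  diag_mx (\row_i \sum_j adj G j i).

Definition weight_balanced (R : realType) (n : nat) (G : wdigraph R n) : Prop :=
  outdeg_mx G = indeg_mx G.

Definition strongly_connected (R : realType) (n : nat) (G : wdigraph R n) :
    Prop :=
  forall i j, i != j -> connect (edge G) i j.

Definition laplacian (R : realType) (n : nat) (G : wdigraph R n) : 'M[R]_n :=
  indeg_mx G - adj G.

Definition ones (R : realType) (n : nat) : 'cV[R]_n := const_mx 1.

(* \mxdiag and \mxcol produce matrices of height \sum_(i < n) m, whereas the
   Kronecker product *t produces height n * m; both index sets are ordered
   lexicographically, so that the casts below place block i, entry a at
   mxtens_index (i, a): see blkdiagE and stackE. *)
Lemma sum_ord_const (n m : nat) : (\sum_(i < n) m = n * m)%N.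
Proof. by rewrite sum_nat_const card_ord. Qed.

Definition blkdiag (R : realType) (n m : nat) (B : 'I_n -> 'M[R]_m) :
    'M[R]_(n * m) :=
  castmx (sum_ord_const n m, sum_ord_const n m) (\mxdiag_(i < n) B i).

Definition stack (R : realType) (n m : nat) (b : 'I_n -> 'cV[R]_m) :
    'cV[R]_(n * m) :=
  castmx (sum_ord_const n m, erefl 1%N) (\mxcol_(i < n) b i).

Lemma cast_mxtens_index (n m : nat) (i : 'I_n) (a : 'I_m) :
  cast_ord (esym (sum_ord_const n m)) (mxtens_index (i, a)) =
  tagnat.Rank (p_ := fun=> m) i a.
Proof.
apply: val_inj; rewrite [RHS](tagnat.RankEsum (p_ := fun=> m)) /=.
by rewrite (big_ord_narrow (ltnW (ltn_ord i))) sum_ord_const.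
Qed.

Lemma blkdiagE (R : realType) (n m : nat) (B : 'I_n -> 'M[R]_m) i j a c :
  blkdiag B (mxtens_index (i, a)) (mxtens_index (j, c)) =
  if i == j then B i a c else 0.
Proof.
rewrite castmxE !cast_mxtens_index.
have /matrixP/(_ a c) := mxblockK
  (fun k l => if k == l then conform_mx 0 (B k) else 0 : 'M[R]_m) i j.
by rewrite mxE => ->; case: eqP => _; rewrite ?conform_mx_id // mxE.
Qed.

Lemma stackE (R : realType) (n m : nat) (b : 'I_n -> 'cV[R]_m) i a :
  stack b (mxtens_index (i, a)) 0 = b i a 0.
Proof.
rewrite castmxE cast_mxtens_index.
have /matrixP/(_ a 0) := mxcolK b i.
by rewrite mxE cast_ord_id.
Qed.

Definition enorm (R : realType) (N : nat) (v : 'cV[R]_N) : R :=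
  Num.sqrt (\sum_i v i 0 ^+ 2).

(* Solutions on [0, +oo[ of the autonomous equation x' = F x; x is only
   constrained on [0, +oo[, being continuous there (from the right at 0). *)
Definition trajectory (R : realType) (N : nat) (F : 'cV[R]_N -> 'cV[R]_N)
    (x : R -> 'cV[R]_N) : Prop :=
  {within `[0, +oo[, continuous x} /\
  forall t : R, 0 < t -> is_derive t (1 : R) x (F (x t)).

Definition exp_converges (R : realType) (N : nat) (z : R -> 'cV[R]_N)
    (zs : 'cV[R]_N) : Prop :=
  exists C mu : R, [/\ 0 < C, 0 < mu &
    forall t : R, 0 <= t -> enorm (z t - zs) <= C * expR (- mu * t)].

(* Main.v *)
Require Import Defs.
From HB Require Import structures.
From mathcomp Require Import all_boot all_order all_algebra.
From mathcomp Require Import mxtens ring lra.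
From mathcomp Require Import all_classical all_reals all_analysis.

Set Implicit Arguments.
Unset Strict Implicit.
Unset Printing Implicit Defensive.

Import Order.TTheory GRing.Theory Num.Theory.
Import numFieldNormedType.Exports.

Local Open Scope ring_scope.

(** Fix a solution xp of [A x = b] and put [x0 := 1 (x) xp].  The consensus term
    vanishes at [x0] and so does the residual [U^T (bA x0 - bb)], which is
    [A xp - b].  The field is therefore [z |-> - M (z - x0)], where
    [M := alpha L + beta B^T B] and [B := U^T bA] is the row of blocks
    [A_1 ... A_n].

    Weight balance makes the quadratic form of the Laplacian a sum of squares
    (laplacian_dot), so the form [z^T M z = alpha z^T L z + beta |B z|^2] is
    nonnegative although [M] need not be symmetric.  By strong connectivity it
    vanishes only at the vectors [1 (x) y] with [A y = 0], and these are killed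
    by both [M] and [M^T].

    What remains is a fact about linear flows (psd_flow_cvg).  Let
    [S := M + M^T].  The component of [x - x0] in [ker S] is constant, because
    [M^T] annihilates that kernel.  The other component y stays in the image of [S],
    where [S] is coercive (psd_coercive_im); as the derivative of [|y|^2] is
    [- y^T S y], Gronwall's argument gives [|y|^2 <= exp (- c t) |y 0|^2].
    The limit is [x0 + k] with k in [ker S], hence k is [1 (x) y] with
    [A y = 0], and the limit is [1 (x) (xp + y)]. *)

(** * The Euclidean inner product and positive semidefinite forms *)

Definition dot (R : realType) (N : nat) (u v : 'cV[R]_N) : R := (u^T *m v) 0 0.

Lemma dot_mulmx (R : realType) (p N : nat) (M : 'M[R]_(p, N)) u v :
  dot u (M *m v) = dot (M^T *m u) v.
Proof. by rewrite /dot trmx_mul trmxK mulmxA. Qed.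

Section InnerProduct.
Variables (R : realType) (N : nat).
Implicit Types (u v w : 'cV[R]_N) (M S : 'M[R]_N).

Lemma dotE u v : dot u v = \sum_i u i 0 * v i 0.
Proof. by rewrite /dot mxE; apply: eq_bigr => i _; rewrite mxE. Qed.

Lemma dotC u v : dot u v = dot v u.
Proof. by rewrite !dotE; apply: eq_bigr => i _; rewrite mulrC. Qed.

Lemma dotDr u v w : dot u (v + w) = dot u v + dot u w.
Proof. by rewrite /dot mulmxDr mxE. Qed.

Lemma dotZr u a v : dot u (a *: v) = a * dot u v.
Proof. by rewrite /dot -scalemxAr mxE. Qed.

Lemma dotNr u v : dot u (- v) = - dot u v.
Proof. by rewrite -scaleN1r dotZr mulN1r. Qed.

Lemma dotDl u v w : dot (u + v) w = dot u w + dot v w.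
Proof. by rewrite dotC dotDr dotC [dot w v]dotC. Qed.

Lemma dotZl a u v : dot (a *: u) v = a * dot u v.
Proof. by rewrite dotC dotZr dotC. Qed.

Lemma dotNl u v : dot (- u) v = - dot u v.
Proof. by rewrite dotC dotNr dotC. Qed.

Lemma dot0r u : dot u 0 = 0.
Proof. by rewrite -(scale0r 0) dotZr mul0r. Qed.

Lemma dot_ge0 u : 0 <= dot u u.
Proof. by rewrite dotE; apply: sumr_ge0 => i _; rewrite -expr2 sqr_ge0. Qed.

Lemma dot_eq0 u : dot u u = 0 -> u = 0.
Proof.
rewrite dotE => /eqP; rewrite psumr_eq0 => [/allP u0|i _]; last first.
  by rewrite -expr2 sqr_ge0.
apply/colP => i; have /= := u0 i (mem_index_enum _).
by rewrite mulf_eq0 orbb !mxE => /eqP.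
Qed.

Lemma enormE u : enorm u = Num.sqrt (dot u u).
Proof. by rewrite /enorm dotE. Qed.

(** Every entry of u is at most [|u|] in absolute value, so the sum of the
    absolute values of the entries of M is an admissible constant; the summand
    1 makes it positive also when M is zero. *)
Lemma dot_mulmx_bound M :
  exists2 C : R, 0 < C & forall u, dot u (M *m u) <= C * dot u u.
Proof.
exists (1 + \sum_i \sum_j `|M i j|).
  by rewrite ltr_wpDr// sumr_ge0// => i _; rewrite sumr_ge0.
move=> u; rewrite mulrDl mul1r ler_wpDl ?dot_ge0// [leLHS]dotE mulr_suml.
apply: ler_sum => i _; rewrite mxE mulr_sumr mulr_suml; apply: ler_sum => j _.
have sq_le k : u k 0 ^+ 2 <= dot u u.
  rewrite dotE (bigD1 k)//= -expr2 lerDl sumr_ge0// => l _.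
  by rewrite -expr2 sqr_ge0.
have le_uu : `|u i 0 * u j 0| <= dot u u.
  have := sq_le i; have := sq_le j; rewrite ler_norml; nra.
rewrite mulrCA (le_trans (ler_norm _))// normrM ler_wpM2l//.
Qed.

(** The kernel and the image of a symmetric real matrix meet trivially, since
    [S (S w) = 0] gives [|S w|^2 = w^T S S w = 0]; by the rank formula they then
    span the whole space. *)
Lemma sym_ker_im S (u : 'cV[R]_N) : S^T = S ->
  exists k w, S *m k = 0 /\ u = k + S *m w.
Proof.
move=> Ssym.
have cap0 : (kermx S :&: S = 0)%MS.
  apply/eqP; rewrite -submx0; apply/row_subP => i.
  set r := row i _.
  have : (r <= kermx S :&: S)%MS by exact: row_sub.
  rewrite sub_capmx => /andP[/sub_kermxP rS /submxP[w rE]].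
  suff -> : r = 0 by rewrite sub0mx.
  apply: trmx_inj; rewrite trmx0; apply: dot_eq0.
  by rewrite {2}rE trmx_mul Ssym dot_mulmx Ssym -[S *m _]trmxK trmx_mul Ssym
    trmxK rS trmx0 dotC dot0r.
have full : row_full (kermx S + S)%MS.
  rewrite -col_leq_rank; have := mxrank_sum_cap (kermx S) S.
  by rewrite cap0 mxrank0 addn0 mxrank_ker => ->; rewrite subnK// rank_leq_row.
have /sub_addsmxP[[a b] /= uE] : (u^T <= kermx S + S)%MS by exact: submx_full.
exists (a *m kermx S)^T, b^T; split.
  apply: trmx_inj.
  by rewrite trmx_mul trmxK Ssym -mulmxA mulmx_ker mulmx0 trmx0.
by apply: trmx_inj; rewrite uE [RHS]linearD /= !trmx_mul !trmxK Ssym.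
Qed.

(** Let T be a linear right inverse of S on its image, and let C bound the
    quadratic form of T.  For y in the image and [v := T y], so that [S v = y],
    evaluating the form of S at [y - s v] gives
    [0 <= y^T S y - 2 s |y|^2 + s^2 v^T y].  With [v^T y <= C |y|^2] and
    [s := 1 / C] this is the claim with constant [1 / C]. *)
Lemma psd_coercive_im S : S^T = S -> (forall u, 0 <= dot u (S *m u)) ->
  exists2 c : R, 0 < c &
    forall w, c * dot (S *m w) (S *m w) <= dot (S *m w) (S *m (S *m w)).
Proof.
move=> Ssym Spsd; pose T := (pinvmx S)^T.
have STS w : S *m (T *m (S *m w)) = S *m w.
  apply: trmx_inj; rewrite !trmx_mul Ssym /T trmxK.
  by rewrite mulmxKpV// submxMl.
have [C C0 TC] := dot_mulmx_bound T^T.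
exists C^-1; first by rewrite invr_gt0.
move=> w; set y := S *m w; set v := T *m y.
have Sv : S *m v = y by exact: STS.
have qv : dot v y <= C * dot y y.
  by apply: le_trans (TC y); rewrite dot_mulmx trmxK.
have := Spsd (y - C^-1 *: v).
rewrite mulmxBr -scalemxAr Sv !dotDl !dotNl !dotDr !dotNr !dotZl !dotZr.
rewrite [dot v (S *m y)]dot_mulmx Ssym Sv.
have : C^-1 * (C^-1 * dot v y) <= C^-1 * dot y y.
  by rewrite ler_pM2l ?invr_gt0// ler_pdivrMl.
lra.
Qed.

End InnerProduct.

(** * Derivatives along trajectories *)

Section Calculus.
Local Open Scope classical_set_scope.
Local Open Scope ring_scope.
Variable R : realType.

Lemma derive_le0_le (f df : R -> R) :
  {within `[0, +oo[, continuous f} ->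
  (forall t : R, 0 < t -> is_derive t (1 : R) f (df t)) ->
  (forall t : R, 0 < t -> df t <= 0) ->
  forall t : R, 0 <= t -> f t <= f 0.
Proof.
move=> cf dfE df0 t; rewrite le_eqVlt => /predU1P[<-//|t0].
have [s | |s] := @MVT R f df 0 t t0.
- by rewrite in_itv/= => /andP[s0 _]; exact: dfE.
- apply: continuous_subspaceW cf => s /=.
  by rewrite !in_itv/= => /andP[-> _].
rewrite in_itv/= => /andP[s0 _] fE.
by rewrite -subr_le0 fE subr0 mulr_le0_ge0 ?df0// ltW.
Qed.

Section Coordinates.
Variable N : nat.
Implicit Types (x y : R -> 'cV[R]_N) (u : 'cV[R]_N).

Lemma is_derive_coord x dx t i :
  is_derive t (1 : R) x dx -> is_derive t (1 : R) (fun s => x s i 0) (dx i 0).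
Proof.
move=> [xt dxE]; split; first exact: (derivable_mxP x t 1).1.
by rewrite -dxE derive_mx// mxE.
Qed.

Lemma is_derive_dot x y dx dy t :
  is_derive t (1 : R) x dx -> is_derive t (1 : R) y dy ->
  is_derive t (1 : R) (fun s => dot (x s) (y s)) (dot (x t) dy + dot dx (y t)).
Proof.
move=> dxt dyt; have -> : (fun s => dot (x s) (y s)) =
    \sum_i ((fun s => x s i 0) * (fun s => y s i 0) : R -> R).
  by apply/funext => s; rewrite fct_sumE dotE.
apply: is_derive_eq.
  apply: is_derive_sum => i.
  exact: is_deriveM (is_derive_coord i dxt) (is_derive_coord i dyt).
rewrite /= !dotE -big_split; apply: eq_bigr => i _ /=.
by rewrite [dx i 0 * _]mulrC.
Qed.

Lemma continuous_coord (D : set R) x i :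
  {within D, continuous x} -> {within D, continuous (fun s => x s i 0)}.
Proof.
pose coord (u : 'cV[R]_N) := u i 0.
by apply: (@within_continuous_comp _ _ _ D x coord) => M _;
  exact: coord_continuous.
Qed.

Lemma continuous_dot (D : set R) x y :
  {within D, continuous x} -> {within D, continuous y} ->
  {within D, continuous (fun s => dot (x s) (y s))}.
Proof.
move=> cx cy; have -> : (fun s => dot (x s) (y s)) =
    (fun s => \sum_i x s i 0 * y s i 0).
  by apply/funext => s; rewrite dotE.
move=> s; apply: (@cvg_big _ _ +%R) => [|i _]; first exact: add_continuous.
by apply: cvgM; apply: continuous_coord.
Qed.

End Coordinates.
End Calculus.

(** * Convergence of dissipative linear flows *)

Section Flow.
Local Open Scope classical_set_scope.
Local Open Scope ring_scope.
Variables (R : realType) (N : nat) (M : 'M[R]_N).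
Hypothesis M_ge0 : forall u, 0 <= dot u (M *m u).
Hypothesis M_ker : forall u, dot u (M *m u) = 0 -> M *m u = 0 /\ M^T *m u = 0.

Let S := M + M^T.

Let S_sym : S^T = S.
Proof. by rewrite /S linearD/= trmxK addrC. Qed.

Let dotS (u : 'cV[R]_N) : dot u (S *m u) = 2 * dot u (M *m u).
Proof.
by rewrite mulmxDl dotDr [X in _ + X]dot_mulmx trmxK [X in _ + X]dotC mulr_natl
  mulr2n.
Qed.

Let S_ker (u : 'cV[R]_N) : S *m u = 0 -> M *m u = 0 /\ M^T *m u = 0.
Proof.
move=> Su; apply: M_ker; apply/eqP.
by have /eqP := dotS u; rewrite Su dot0r eq_sym mulf_eq0 pnatr_eq0.
Qed.

(** The limit is the value at time 0 of the component of x along [x0 + ker S],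
    for [S := M + M^T]; the other component decays at rate [c / 2], c being the
    coercivity constant of S on its image.  The hypothesis M_ker excludes for
    instance a nonzero skew-symmetric M, whose flow is a rotation. *)
Lemma psd_flow_cvg (x : R -> 'cV[R]_N) (x0 : 'cV[R]_N) :
  trajectory (fun z => - (M *m (z - x0))) x ->
  exists2 k, dot k (M *m k) = 0 & exp_converges x (x0 + k).
Proof.
move=> [cx dx].
have S_ge0 u : 0 <= dot u (S *m u) by rewrite dotS mulr_ge0.
have [k [w0 [Sk x0E]]] := sym_ker_im (x 0 - x0) S_sym.
have [Mk MTk] := S_ker Sk.
exists k; first by rewrite Mk dot0r.
have [c c0 Sc] := psd_coercive_im S_sym S_ge0.
pose y (t : R) := x t - (x0 + k).
have cy : {within `[0, +oo[, continuous y}.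
  by move=> t; apply: cvgB; [exact: cx | exact: cvg_cst].
have dy (t : R) : 0 < t -> is_derive t (1 : R) y (- (M *m y t)).
  move=> t0; apply: is_derive_eq.
    by apply: is_deriveB; exact: dx.
  by rewrite subr0 /y opprD addrA [in RHS]mulmxBr Mk subr0.
(* M^T annihilates ker S, so each coordinate of y along ker S is constant. *)
have y_im (t : R) : 0 <= t -> exists w, y t = S *m w.
  move=> t0; have [l [w [Sl yE]]] := sym_ker_im (y t) S_sym.
  have [_ MTl] := S_ker Sl; exists w; rewrite yE.
  have dl (s : R) : 0 < s -> is_derive s (1 : R) (fun s => dot l (y s)) 0.
    move=> s0; apply: is_derive_eq.
      by apply: is_derive_dot; exact: dy.
    by rewrite dotNr dot_mulmx MTl addNr.
  have ly0 : dot l (y t) <= dot l (y 0).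
    apply: (@derive_le0_le _ (fun s => dot l (y s)) (fun=> 0)) => //.
    by apply: continuous_dot => // s; exact: cvg_cst.
  have lS v : dot l (S *m v) = 0 by rewrite dot_mulmx S_sym Sl dotC dot0r.
  have y0E : y 0 = S *m w0 by rewrite /y opprD addrA x0E addrAC subrr add0r.
  suff -> : l = 0 by rewrite add0r.
  apply: dot_eq0; apply/eqP; rewrite eq_le dot_ge0 andbT.
  by move: ly0; rewrite y0E yE dotDr !lS addr0.
pose V (t : R) := dot (y t) (y t).
have cV : {within `[0, +oo[, continuous V} by exact: continuous_dot.
have dV (t : R) : 0 < t -> is_derive t (1 : R) V (- dot (y t) (S *m y t)).
  move=> t0; apply: is_derive_eq.
    by apply: is_derive_dot; exact: dy.
  rewrite dotS [dot (- _) _]dotC dotNr; ring.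
(* Gronwall: the derivative of expR (c * t) * V t is nonpositive. *)
have decay (t : R) : 0 <= t -> expR (c * t) * V t <= V 0.
  pose E (s : R) : R := expR (c * s).
  have dE (s : R) : is_derive s (1 : R) E (E s * c).
    apply: (@is_derive1_comp _ expR ( *%R c) s (expR (c * s)) c).
    by apply: is_derive_eq; rewrite [_%:A]mulr1.
  pose dEV s := E s * - dot (y s) (S *m y s) + V s * (E s * c).
  move=> t0; have <- : E 0 * V 0 = V 0 by rewrite /E mulr0 expR0 mul1r.
  apply: (@derive_le0_le _ (E * V) dEV) t0.
  - have cE : {within `[0, +oo[, continuous E}.
      apply: continuous_subspaceT => r.
      by apply/differentiable_continuous/derivable1_diffP; case: (dE r).
    by move=> s; exact: cvgM (cE s) (cV s).
  - by move=> s s0; exact: is_deriveM (dE s) (dV s s0).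
  - move=> s s0; have [w yE] := y_im s (ltW s0).
    rewrite /dEV mulrN addrC subr_le0 mulrCA ler_pM2l ?expR_gt0//.
    by rewrite mulrC /V yE.
(* The summand 1 only serves to make the constant positive when y 0 = 0. *)
exists (Num.sqrt (V 0) + 1), (c / 2); split.
- by rewrite ltr_wpDl ?sqrtr_ge0.
- by rewrite divr_gt0.
move=> t t0; rewrite enormE -/(y t) -/(V t).
have : V t <= (Num.sqrt (V 0) * expR (- (c / 2) * t)) ^+ 2.
  rewrite exprMn sqr_sqrtr ?dot_ge0// expr2 -expRD.
  rewrite (_ : _ + _ = - (c * t)); last by field.
  by rewrite expRN ler_pdivlMr ?expR_gt0// mulrC decay.
move=> /ler_wsqrtr /le_trans -> //.
rewrite sqrtr_sqr ger0_norm ?mulr_ge0 ?sqrtr_ge0 ?expR_ge0//.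
by rewrite ler_pM2r ?expR_gt0// lerDl.
Qed.

End Flow.

(** * The Laplacian of a weight-balanced digraph *)

Section Laplacian.
Variables (R : realType) (n : nat) (G : wdigraph R n).
Hypothesis hwb : weight_balanced G.
Implicit Types f : 'cV[R]_n.

Lemma adj_ge0 i j : 0 <= adj G i j.
Proof.
by case: (boolP (edge G i j)) => [/adj_gt0/ltW//|/adj_eq0->].
Qed.

Lemma degrees_eq i : \sum_j adj G i j = \sum_j adj G j i.
Proof.
have /matrixP/(_ i i) := hwb.
by rewrite !mxE eqxx !mulr1n.
Qed.

(** Weight balance is used here: the Laplacian is defined with in-degrees, but
    its rows sum to zero because these are also the out-degrees. *)
Lemma laplacianE f i :
  (laplacian G *m f) i 0 = \sum_j adj G i j * (f i 0 - f j 0).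
Proof.
rewrite mulmxBl mul_diag_mx !mxE -degrees_eq mulr_suml -sumrB.
by apply: eq_bigr => j _; rewrite mulrBr.
Qed.

Lemma laplacian_trE f i :
  ((laplacian G)^T *m f) i 0 = \sum_j adj G j i * (f i 0 - f j 0).
Proof.
rewrite linearB/= tr_diag_mx mulmxBl mul_diag_mx !mxE mulr_suml -sumrB.
by apply: eq_bigr => j _; rewrite mulrBr !mxE.
Qed.

Lemma laplacian_ones : laplacian G *m ones R n = 0.
Proof.
apply/colP => i; rewrite laplacianE big1 ?mxE// => j _.
by rewrite !mxE subrr mulr0.
Qed.

Lemma laplacian_tr_ones : (laplacian G)^T *m ones R n = 0.
Proof.
apply/colP => i; rewrite laplacian_trE big1 ?mxE// => j _.
by rewrite !mxE subrr mulr0.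
Qed.

(** [2 f^T L f] is the sum of the form of L written with outgoing edges and
    that of its transpose written with incoming edges.  After exchanging the
    summations in the latter, the edge (i, j) contributes
    [a_ij (f_i (f_i - f_j) + f_j (f_j - f_i))], which is a square. *)
Lemma laplacian_dot f :
  2 * dot f (laplacian G *m f)
  = \sum_i \sum_j adj G i j * (f i 0 - f j 0) ^+ 2.
Proof.
rewrite mulr_natl mulr2n {2}dot_mulmx [dot (_ *m _) f]dotC !dotE -big_split/=.
have -> : \sum_i (f i 0 * (laplacian G *m f) i 0 +
                  f i 0 * ((laplacian G)^T *m f) i 0) =
  \sum_i \sum_j f i 0 * (adj G i j * (f i 0 - f j 0)) +
  \sum_j \sum_i f j 0 * (adj G i j * (f j 0 - f i 0)).
  rewrite big_split/=; congr (_ + _); apply: eq_bigr => i _.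
    by rewrite laplacianE mulr_sumr.
  by rewrite laplacian_trE mulr_sumr.
rewrite [X in _ + X]exchange_big -big_split/=; apply: eq_bigr => i _.
by rewrite -big_split/=; apply: eq_bigr => j _; ring.
Qed.

Lemma laplacian_ge0 f : 0 <= dot f (laplacian G *m f).
Proof.
suff : 0 <= 2 * dot f (laplacian G *m f) by rewrite pmulr_rge0.
rewrite laplacian_dot; apply: sumr_ge0 => i _; apply: sumr_ge0 => j _.
by rewrite mulr_ge0 ?adj_ge0 ?sqr_ge0.
Qed.

Lemma laplacian_dot_eq0 f : strongly_connected G ->
  dot f (laplacian G *m f) = 0 -> forall i j, f i 0 = f j 0.
Proof.
move=> hsc /(congr1 ( *%R 2)); rewrite laplacian_dot mulr0 => f0.
have term_ge0 i j : 0 <= adj G i j * (f i 0 - f j 0) ^+ 2.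
  by rewrite mulr_ge0 ?adj_ge0 ?sqr_ge0.
have edge_eq i j : edge G i j -> f i 0 = f j 0.
  move=> /(@adj_gt0 _ _ G) aij; apply/eqP; rewrite -subr_eq0.
  have row_ge0 k (_ : true) : 0 <= \sum_l adj G k l * (f k 0 - f l 0) ^+ 2.
    by rewrite sumr_ge0.
  have fi0 := psumr_eq0P row_ge0 f0 (i := i) isT.
  have /eqP := psumr_eq0P (fun l _ => term_ge0 i l) fi0 (i := j) isT.
  by rewrite mulf_eq0 gt_eqF//= sqrf_eq0.
have path_eq i j : connect (edge G) i j -> f i 0 = f j 0.
  move=> /connectP[p + ->]; elim: p i => //= k p IH i /andP[/edge_eq->].
  exact: IH.
by move=> i j; have [->//|/hsc/path_eq] := eqVneq i j.
Qed.

End Laplacian.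

(** * Block vectors and Kronecker products *)

Section Blocks.
Variables (R : realType) (n m : nat).
Implicit Types (z w : 'cV[R]_(n * m)) (y : 'cV[R]_m).

Lemma sum_mxtens (V : nmodType) (p q : nat) (F : 'I_(p * q) -> V) :
  \sum_k F k = \sum_i \sum_a F (mxtens_index (i, a)).
Proof.
rewrite pair_bigA/= (reindex (@mxtens_index p q))/=.
  by apply: eq_bigr => -[].
by exists (@mxtens_unindex p q) => ? _;
  rewrite ?mxtens_indexK ?mxtens_unindexK.
Qed.

(** Component a of every block: a Kronecker product with the identity on the
    right acts on each slice separately. *)
Definition slice z (a : 'I_m) : 'cV[R]_n := \col_i z (mxtens_index (i, a)) 0.

Lemma slice_tens1 (B : 'M[R]_n) z a :
  slice ((B *t (1%:M : 'M[R]_m)) *m z) a = B *m slice z a.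
Proof.
apply/colP => i; rewrite !mxE sum_mxtens; apply: eq_bigr => j _.
rewrite (bigD1 a)//= big1 => [|c ca]; rewrite tensmxE !mxE ?eqxx.
  by rewrite mulr1 addr0.
by rewrite eq_sym (negPf ca) mulr0 mul0r.
Qed.

Lemma slice0 a : slice 0 a = 0.
Proof. by apply/colP => i; rewrite !mxE. Qed.

Lemma dot_slice z w : dot z w = \sum_a dot (slice z a) (slice w a).
Proof.
rewrite dotE sum_mxtens exchange_big/=; apply: eq_bigr => a _.
by rewrite dotE; apply: eq_bigr => i _; rewrite !mxE.
Qed.

Lemma slice_inj z w : (forall a, slice z a = slice w a) -> z = w.
Proof.
move=> zw; apply/colP => k; case: (mxtens_indexP k) => i a.
by have /colP/(_ i) := zw a; rewrite !mxE.
Qed.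

Lemma tens_onesE y i a : (ones R n *t y) (mxtens_index (i, a)) 0 = y a 0.
Proof.
by rewrite mxE mxtens_indexK/= mxE mul1r; congr (y _ _); apply: val_inj.
Qed.

Lemma tens_onesD y1 y2 :
  ones R n *t (y1 + y2) = ones R n *t y1 + ones R n *t y2.
Proof. by apply/colP => k; rewrite !mxE mulrDr. Qed.

Lemma slice_ones y a : slice (ones R n *t y) a = y a 0 *: ones R n.
Proof. by apply/colP => i; rewrite mxE tens_onesE !mxE mulr1. Qed.

(** This is [U^T z], but indexed by ['I_m] and not by ['I_(1 * m)]. *)
Definition block_sum z : 'cV[R]_m := \col_a \sum_i z (mxtens_index (i, a)) 0.

Lemma block_sumB z w : block_sum (z - w) = block_sum z - block_sum w.
Proof.
by apply/colP => a; rewrite !mxE -sumrB; apply: eq_bigr => i _; rewrite !mxE.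
Qed.

Let U : 'M[R]_(n * m, 1 * m) := ones R n *t (1%:M : 'M[R]_m).

Lemma tr_ones_tensE z a :
  (U^T *m z) (mxtens_index (0, a)) 0 = block_sum z a 0.
Proof.
rewrite !mxE sum_mxtens; apply: eq_bigr => i _.
rewrite (bigD1 a)//= big1 => [|c ca]; rewrite mxE tensmxE !mxE ?eqxx.
  by rewrite !mul1r addr0.
by rewrite (negPf ca) mulr0 mul0r.
Qed.

Lemma tr_ones_tens_eq0 z : U^T *m z = 0 <-> block_sum z = 0.
Proof.
split => [Uz|bz]; apply/colP => k.
  by rewrite -tr_ones_tensE Uz !mxE.
by case: (mxtens_indexP k) => i a; rewrite ord1 tr_ones_tensE bz !mxE.
Qed.

Lemma block_sum_blkdiag_ones (A : 'I_n -> 'M[R]_m) y :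
  block_sum (blkdiag A *m (ones R n *t y)) = (\sum_i A i) *m y.
Proof.
apply/colP => a; rewrite mulmx_suml summxE mxE; apply: eq_bigr => i _.
rewrite !mxE sum_mxtens (bigD1 i)//= [X in _ + X]big1 ?addr0 => [|j ji].
  by apply: eq_bigr => c _; rewrite blkdiagE eqxx tens_onesE.
by apply: big1 => c _; rewrite blkdiagE eq_sym (negPf ji) mul0r.
Qed.

Lemma block_sum_stack (b : 'I_n -> 'cV[R]_m) : block_sum (stack b) = \sum_i b i.
Proof.
by apply/colP => a; rewrite mxE summxE; under eq_bigr do rewrite stackE.
Qed.

End Blocks.

(** * The Laplacian acting on block vectors *)

Section KroneckerLaplacian.
Variables (R : realType) (n m : nat) (G : wdigraph R n).
Hypothesis hwb : weight_balanced G.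

Let L : 'M[R]_(n * m) := laplacian G *t (1%:M : 'M[R]_m).

Lemma kron_laplacian_ge0 z : 0 <= dot z (L *m z).
Proof.
rewrite dot_slice; apply: sumr_ge0 => a _.
by rewrite slice_tens1 laplacian_ge0.
Qed.

Lemma kron_laplacian_dot_eq0 z : strongly_connected G -> (0 < n)%N ->
  dot z (L *m z) = 0 -> exists y : 'cV[R]_m, z = ones R n *t y.
Proof.
move=> hsc n0 zLz.
exists (\col_a z (mxtens_index (Ordinal n0, a)) 0).
apply: slice_inj => a; rewrite slice_ones.
have slice_ge0 c (_ : true) : 0 <= dot (slice z c) (slice (L *m z) c).
  by rewrite slice_tens1 laplacian_ge0.
rewrite dot_slice in zLz.
have := psumr_eq0P slice_ge0 zLz (i := a) isT; rewrite slice_tens1.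
move=> /(laplacian_dot_eq0 hwb hsc) fE; apply/colP => i.
by rewrite (fE _ (Ordinal n0)) !mxE mulr1.
Qed.

Lemma kron_laplacian_ones (y : 'cV[R]_m) :
  L *m (ones R n *t y) = 0 /\ L^T *m (ones R n *t y) = 0.
Proof.
split; apply: slice_inj => a.
  by rewrite slice_tens1 slice_ones -scalemxAr laplacian_ones// scaler0 slice0.
rewrite trmx_tens trmx1 slice_tens1 slice_ones -scalemxAr laplacian_tr_ones.
by rewrite scaler0 slice0.
Qed.

End KroneckerLaplacian.

(** * Convergence of the consensus dynamics *)

Theorem mainTheorem2 (R : realType) (n m : nat) (hn : (2 <= n)%N)
    (G : wdigraph R n) (hsc : strongly_connected G) (hwb : weight_balanced G)
    (A : 'I_n -> 'M[R]_m) (b : 'I_n -> 'cV[R]_m)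
    (hsol : exists x : 'cV[R]_m, (\sum_i A i) *m x = \sum_i b i)
    (alpha beta : R) (halpha : 0 < alpha) (hbeta : 0 < beta) :
  let L : 'M[R]_(n * m) := laplacian G *t (1%:M : 'M[R]_m) in
  let bA : 'M[R]_(n * m) := blkdiag A in
  let bb : 'cV[R]_(n * m) := stack b in
  let U : 'M[R]_(n * m, 1 * m) := ones R n *t (1%:M : 'M[R]_m) in
  forall x : R -> 'cV[R]_(n * m),
    trajectory (fun z => - (alpha *: (L *m z))
                         - beta *: (bA^T *m U *m U^T *m (bA *m z - bb))) x ->
    exists xs : 'cV[R]_m,
      (\sum_i A i) *m xs = \sum_i b i /\
      exp_converges x (ones R n *t xs).
Proof.
move=> L bA bb U x.
have [xp xpE] := hsol.
pose x0 : 'cV[R]_(n * m) := ones R n *t xp.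
pose B := U^T *m bA.
pose M := alpha *: L + beta *: (B^T *m B).
have B_ones (y : 'cV[R]_m) : B *m (ones R n *t y) = 0 <-> (\sum_i A i) *m y = 0.
  by rewrite -mulmxA tr_ones_tens_eq0 block_sum_blkdiag_ones.
have resid0 : U^T *m (bA *m x0 - bb) = 0.
  apply/tr_ones_tens_eq0.
  by rewrite block_sumB block_sum_blkdiag_ones block_sum_stack xpE subrr.
have fieldE z :
    - (alpha *: (L *m z)) - beta *: (bA^T *m U *m U^T *m (bA *m z - bb)) =
    - (M *m (z - x0)).
  have -> : bA *m z - bb = bA *m (z - x0) + (bA *m x0 - bb).
    by rewrite mulmxBr addrA subrK.
  rewrite -[_ *m U^T *m _]mulmxA [U^T *m _]mulmxDr resid0 addr0.
  rewrite mulmxDl opprD -!scalemxAl [L *m (z - _)]mulmxBr.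
  by rewrite (kron_laplacian_ones hwb xp).1 subr0 /B trmx_mul trmxK !mulmxA.
have dotM z : dot z (M *m z) =
    alpha * dot z (L *m z) + beta * dot (B *m z) (B *m z).
  rewrite mulmxDl dotDr -!scalemxAl !dotZr -mulmxA; congr (_ + _ * _).
  by rewrite dot_mulmx trmxK.
have dotM0 z : dot z (M *m z) = 0 ->
    exists2 y : 'cV[R]_m, z = ones R n *t y & (\sum_i A i) *m y = 0.
  rewrite dotM => /eqP; rewrite paddr_eq0; last 2 first.
  - by rewrite mulr_ge0 ?kron_laplacian_ge0// ltW.
  - by rewrite mulr_ge0 ?dot_ge0// ltW.
  rewrite !mulf_eq0 (gt_eqF halpha) (gt_eqF hbeta)/=.
  move=> /andP[/eqP zLz /eqP/dot_eq0 Bz].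
  have [y zE] := kron_laplacian_dot_eq0 hwb hsc (ltnW hn) zLz.
  by exists y => //; apply/B_ones; rewrite -zE.
have M_ge0 z : 0 <= dot z (M *m z).
  by rewrite dotM addr_ge0// mulr_ge0 ?dot_ge0 ?kron_laplacian_ge0// ltW.
have M_ker z : dot z (M *m z) = 0 -> M *m z = 0 /\ M^T *m z = 0.
  move=> /dotM0[y -> /B_ones By]; have [Ly LTy] := kron_laplacian_ones hwb y.
  split.
    by rewrite mulmxDl -!scalemxAl -mulmxA By Ly mulmx0 !scaler0 addr0.
  rewrite linearD !linearZ/= trmx_mul trmxK mulmxDl -!scalemxAl -mulmxA By LTy.
  by rewrite mulmx0 !scaler0 addr0.
move=> x_traj.
have [|k /dotM0[y -> Ay] x_cvg] := psd_flow_cvg M_ge0 M_ker (x := x) (x0 := x0).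
  by move: x_traj; congr (trajectory _ _); apply/funext => z; exact: fieldE.
exists (xp + y); split; first by rewrite mulmxDr Ay addr0.
by move: x_cvg; rewrite -tens_onesD.
Qed.
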